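(* Let $n$ and $s$ be positive integers. For $\delta\in\{d_C,d_{FS}\}$, $$N_s^{\delta}(1,n)\le\binom{n+2s-1}{n-1}+\binom{n+2s-2}{n-1}.$$
   Context: $\mathrm{Gr}(1,n)$ is the set of lines through the origin (1-dimensional linear subspaces) in $\mathbb{R}^n$. For two lines $\mathbb{U},\mathbb{V}$ forming angle $\theta\in[0,\pi/2]$, the chordal distance is $d_C(\mathbb{U},\mathbb{V})=\sin\theta$ and the Fubini–Study distance is $d_{FS}(\mathbb{U},\mathbb{V})=\theta$. A finite subset $S\subseteq\mathrm{Gr}(1,n)$ is an $s$-distance set with respect to $\delta$ if $|\{\delta(\mathbb{U},\mathbb{V}):\mathbb{U}\ne\mathbb{V},\ \mathbb{U},\mathbb{V}\in S\}|\le s$; $N_s^{\delta}(1,n)$ is the maximum cardinality of such a set. *)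

(* Defs.v *)
From HB Require Import structures.
From mathcomp Require Import all_boot all_order all_algebra.
From mathcomp Require Import finmap.
From mathcomp Require Import all_classical all_reals all_analysis.
Set Implicit Arguments.
Unset Strict Implicit.
Unset Printing Implicit Defensive.
Import Order.TTheory GRing.Theory Num.Theory.
Local Open Scope ring_scope.

Definition Gr (R : realType) (k n : nat) : choiceType :=
  {U : {vspace 'rV[R]_n} | \dim U == k}.

Definition dotv (R : realType) (n : nat) (u v : 'rV[R]_n) : R :=
  \sum_(i < n) u 0 i * v 0 i.

Definition enorm (R : realType) (n : nat) (u : 'rV[R]_n) : R :=
  Num.sqrt (dotv u u).

(* The angle in [0, pi/2] between the lines spanned by the nonzero vectors
   u and v. *)
Definition angle (R : realType) (n : nat) (u v : 'rV[R]_n) : R :=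
  acos (`|dotv u v| / (enorm u * enorm v)).

(* vpick U is some nonzero vector of the line U; line_angleE below shows that
   the angle does not depend on which one. *)
Definition line_angle (R : realType) (n : nat) (U V : Gr R 1 n) : R :=
  angle (vpick (val U)) (vpick (val V)).

Definition d_C (R : realType) (n : nat) (U V : Gr R 1 n) : R :=
  sin (line_angle U V).

Definition d_FS (R : realType) (n : nat) (U V : Gr R 1 n) : R :=
  line_angle U V.

Definition distances (R : realType) (T : choiceType) (delta : T -> T -> R)
    (S : {fset T}) : {fset R} :=
  [fset delta p.1 p.2 | p in (S `*` S)%fset & p.1 != p.2]%fset.

Definition s_distance_set (R : realType) (T : choiceType)
    (delta : T -> T -> R) (s : nat) (S : {fset T}) : Prop :=
  (#|` distances delta S| <= s)%N.

(* N is the maximum cardinality of an s-distance set, i.e. N_s^delta exists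
   and is equal to N. *)
Definition is_max_s_distance (R : realType) (T : choiceType)
    (delta : T -> T -> R) (s N : nat) : Prop :=
  (exists S : {fset T}, s_distance_set delta s S /\ #|` S| = N) /\
  (forall S : {fset T}, s_distance_set delta s S -> (#|` S| <= N)%N).

Lemma distancesP (R : realType) (T : choiceType) (delta : T -> T -> R)
    (S : {fset T}) (d : R) :
  d \in distances delta S <->
  exists U V : T, [/\ U \in S, V \in S, U != V & d = delta U V].
Proof.
split.
  case/imfsetP => -[U V] /=; rewrite !inE /= => /andP[/andP[US VS] UV] ->.
  by exists U, V.
case=> U [V [US VS UV ->]].
by apply/imfsetP; exists (U, V) => //=; rewrite !inE /= US VS UV.
Qed.

Lemma dotvC (R : realType) (n : nat) (u v : 'rV[R]_n) : dotv u v = dotv v u.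
Proof. by apply: eq_bigr => i _; rewrite mulrC. Qed.

Lemma dotvZl (R : realType) (n : nat) (c : R) (u v : 'rV[R]_n) :
  dotv (c *: u) v = c * dotv u v.
Proof. by rewrite /dotv mulr_sumr; apply: eq_bigr => i _; rewrite mxE mulrA. Qed.

Lemma enormZ (R : realType) (n : nat) (c : R) (u : 'rV[R]_n) :
  enorm (c *: u) = `|c| * enorm u.
Proof.
rewrite /enorm dotvZl dotvC dotvZl mulrA -expr2 sqrtrM ?sqr_ge0 //.
by rewrite sqrtr_sqr.
Qed.

Lemma angleC (R : realType) (n : nat) (u v : 'rV[R]_n) : angle u v = angle v u.
Proof. by rewrite /angle dotvC [enorm u * _]mulrC. Qed.

Lemma angleZl (R : realType) (n : nat) (c : R) (u v : 'rV[R]_n) :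
  c != 0 -> angle (c *: u) v = angle u v.
Proof.
move=> c0; rewrite /angle dotvZl enormZ normrM -(mulrA _ (enorm u)).
by rewrite -mulf_div divff ?mul1r // normr_eq0.
Qed.

Lemma vpick_line (R : realType) (n : nat) (U : Gr R 1 n) (u : 'rV[R]_n) :
  u \in val U -> u != 0 -> exists2 c : R, c != 0 & vpick (val U) = c *: u.
Proof.
case: U => U /= /eqP dU uU u0.
have /eqP <- : (<[u]> == U)%VS by rewrite eqEdim -memvE uU dim_vline u0 dU.
have /vlineP[c cE] := memv_pick <[u]>%VS.
exists c => //; apply: contra_neq u0 => c0.
move: cE; rewrite c0 scale0r => /eqP; rewrite vpick0 => /eqP U0.
by apply/eqP; rewrite -memv0 -U0 memv_line.
Qed.

Lemma line_angleE (R : realType) (n : nat) (U V : Gr R 1 n) (u v : 'rV[R]_n) :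
  u \in val U -> u != 0 -> v \in val V -> v != 0 ->
  line_angle U V = angle u v.
Proof.
move=> uU u0 vV v0; rewrite /line_angle.
have [a a0 ->] := vpick_line uU u0; have [b b0 ->] := vpick_line vV v0.
by rewrite angleZl // angleC angleZl // angleC.
Qed.

(* Main.v *)
Require Import Defs.
From mathcomp Require Import all_boot all_order all_algebra.
From mathcomp Require Import finmap.
From mathcomp Require Import all_classical all_reals all_analysis.
From mathcomp Require Import ring zify.

(** Two nonzero vectors [u], [v] on the lines [U], [V] satisfy
    [(u . v)^2 = c |u|^2 |v|^2], where the squared cosine [c] is a function [g]
    of the distance between [U] and [V]; moreover [c = 1] forces [U = V] (the
    equality case of Cauchy-Schwarz).  Let [D] be the set of distances occurring
    in [S], and attach to each line [U] of [S], spanned by [u], the polynomial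
    [F_U(x) = \prod_(d in D) ((u . x)^2 - g(d) |u|^2 |x|^2)].
    It is homogeneous of degree [2 |D|], vanishes on every other line of [S],
    and is nonzero at [u].  A square matrix of values of forms that is diagonal
    with nonzero diagonal has full rank, while its rank is at most the number of
    monomials ([card_le_of_dual_forms]).  Hence
    [|S| <= 'C(n - 1 + 2 s, n - 1)], which is the first of the two binomial
    coefficients of the bound; since the cardinalities are bounded, their
    maximum exists. *)

Set Implicit Arguments.
Unset Strict Implicit.
Unset Printing Implicit Defensive.
Import Order.TTheory GRing.Theory Num.Theory.
Local Open Scope ring_scope.

(** * Homogeneous polynomial functions *)

(** Monomials are encoded by the list of their variables, so that a product of
    monomials is a concatenation; different lists may denote the same
    monomial. *)
Definition monomial (R : realType) (n d : nat) (t : d.-tuple 'I_n)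
  (x : 'rV[R]_n) : R := \prod_(i <- t) x 0 i.

Definition is_form (R : realType) (n d : nat) (f : 'rV[R]_n -> R) : Prop :=
  exists l : seq (R * d.-tuple 'I_n),
    forall x, f x = \sum_(p <- l) p.1 * monomial p.2 x.

Section Forms.
Variables (R : realType) (n : nat).
Implicit Types (f g : 'rV[R]_n -> R).

Lemma is_form1 : is_form 0 (fun _ : 'rV[R]_n => 1).
Proof.
by exists [:: (1, [tuple])] => x; rewrite big_seq1 /monomial big_nil mulr1.
Qed.

Lemma is_form_coord i : is_form 1 (fun x : 'rV[R]_n => x 0 i).
Proof.
by exists [:: (1, [tuple i])] => x; rewrite big_seq1 /monomial big_seq1 mul1r.
Qed.

Lemma is_formD d f g :
  is_form d f -> is_form d g -> is_form d (fun x => f x + g x).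
Proof.
by case=> l lE [m mE]; exists (l ++ m) => x; rewrite big_cat /= lE mE.
Qed.

Lemma is_formZ d c f : is_form d f -> is_form d (fun x => c * f x).
Proof.
case=> l lE; exists [seq (c * p.1, p.2) | p <- l] => x.
by rewrite big_map lE mulr_sumr; apply: eq_bigr => p _; rewrite mulrA.
Qed.

Lemma is_formM d e f g :
  is_form d f -> is_form e g -> is_form (d + e) (fun x => f x * g x).
Proof.
case=> l lE [m mE].
exists [seq (p.1 * q.1, cat_tuple p.2 q.2) | p <- l, q <- m] => x.
rewrite big_allpairs_dep lE mE big_distrlr.
apply: eq_bigr => p _; apply: eq_bigr => q _ /=.
by rewrite mulrACA /monomial big_cat.
Qed.

Lemma is_form_sum d (I : Type) (r : seq I) (f : I -> 'rV[R]_n -> R) :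
  (forall i, is_form d (f i)) -> is_form d (fun x => \sum_(i <- r) f i x).
Proof.
move=> ff; elim: r => [|i r IH].
  by exists [::] => x; rewrite !big_nil.
have [l lE] := is_formD (ff i) IH.
by exists l => x; rewrite big_cons lE.
Qed.

Lemma is_form_prod d (I : Type) (r : seq I) (f : I -> 'rV[R]_n -> R) :
  (forall i, is_form d (f i)) ->
  is_form (size r * d) (fun x => \prod_(i <- r) f i x).
Proof.
move=> ff; elim: r => [|i r IH].
  by have [l lE] := is_form1; exists l => x; rewrite big_nil; apply: lE.
have [l lE] := is_formM (ff i) IH.
by exists l => x; rewrite big_cons lE.
Qed.

Lemma is_form_dotv (u : 'rV[R]_n) : is_form 1 (dotv u).
Proof.
by apply: is_form_sum => i; apply: is_formZ; apply: is_form_coord.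
Qed.

Lemma is_form_dotvv : is_form 2 (fun x : 'rV[R]_n => dotv x x).
Proof.
by apply: is_form_sum => i; apply: (@is_formM 1 1); apply: is_form_coord.
Qed.

End Forms.

(** * The number of monomials *)

Definition sorted_tuples (n d : nat) : {set d.-tuple 'I_n.+1} :=
  [set t : d.-tuple 'I_n.+1 | sorted leq [seq val i | i <- t]].

(** Sorting the list of variables of a monomial gives a normal form, so the
    sorted tuples already span the forms of degree [d]; counting them gives the
    dimension bound. *)
Lemma is_form_sorted (R : realType) (n d : nat) (f : 'rV[R]_n.+1 -> R) :
  is_form d f ->
  exists c : d.-tuple 'I_n.+1 -> R,
    forall x, f x = \sum_(t in sorted_tuples n d) c t * monomial t x.
Proof.
case=> l lE.
pose nf (t : d.-tuple 'I_n.+1) : d.-tuple 'I_n.+1 :=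
  [tuple of sort (relpre val leq) t].
have nf_sorted t : nf t \in sorted_tuples n d.
  by rewrite inE sorted_map; apply: sort_sorted => i j; apply: leq_total.
have nfE t (x : 'rV[R]_n.+1) : monomial (nf t) x = monomial t x.
  by apply: perm_big; rewrite perm_sort.
exists (fun t => \sum_(p <- l | nf p.2 == t) p.1) => x.
rewrite lE (partition_big (fun p => nf p.2) (mem (sorted_tuples n d))) /=; last first.
  by move=> p _; apply: nf_sorted.
apply: eq_bigr => t _; rewrite mulr_suml.
by apply: eq_bigr => p /eqP <-; rewrite nfE.
Qed.

(** The matrix of values [f i (v j)] has full rank because it is diagonal with
    invertible diagonal, and it factors through the space of coefficients, whose
    dimension is the number of monomials. *)
Lemma card_le_of_dual_forms (R : realType) (n d k : nat)
    (f : 'I_k -> 'rV[R]_n.+1 -> R) (v : 'I_k -> 'rV[R]_n.+1) :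
  (forall i, is_form d (f i)) ->
  (forall i j, (f i (v j) == 0) = (i != j)) ->
  (k <= 'C(d + n, d))%N.
Proof.
move=> ff fv.
have [c cE] := fin_all_exists (fun i : 'I_k => is_form_sorted (ff i)).
pose A := sorted_tuples n d.
pose C := \matrix_(i < k, t < #|A|) c i (enum_val t).
pose E := \matrix_(t < #|A|, j < k) monomial (enum_val t) (v j).
have CE i j : (C *m E) i j = f i (v j).
  rewrite cE mxE [RHS]big_enum_val.
  by apply: eq_bigr => t _; rewrite !mxE.
have /eqP rk : row_free (C *m E).
  apply/row_freeP; exists (diag_mx (\row_j (f j (v j))^-1)).
  apply/matrixP => i j; rewrite mul_mx_diag mxE CE !mxE.
  have := fv i j; case: (eqVneq i j) => [-> /negbT fjj | _ /eqP ->].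
    by rewrite divff.
  by rewrite mul0r.
have -> : 'C(d + n, d) = #|A|.
  by rewrite /A /sorted_tuples card_sorted_tuples.
by rewrite -{1}rk; apply: leq_trans (mxrankM_maxl _ _) (rank_leq_col _).
Qed.

(** * The Cauchy-Schwarz inequality and angles *)

Section CauchySchwarz.
Variables (R : realType) (n : nat).
Implicit Types u v : 'rV[R]_n.

Lemma dotv_ge0 u : 0 <= dotv u u.
Proof. by apply: sumr_ge0 => i _; rewrite -expr2 sqr_ge0. Qed.

Lemma dotv_eq0 u : (dotv u u == 0) = (u == 0).
Proof.
apply/idP/eqP => [|->]; last by rewrite /dotv big1 // => i _; rewrite mxE mul0r.
rewrite /dotv psumr_eq0; last by move=> i _; rewrite -expr2 sqr_ge0.
move/allP => h; apply/rowP => i; rewrite mxE.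
by have := h i (mem_index_enum _); rewrite /= mulf_eq0 orbb => /eqP.
Qed.

(** Up to the factor [v . v], the defect in Cauchy-Schwarz is the squared
    length of the component of [u] orthogonal to [v]. *)
Lemma dotv_rejection u v :
  let w := dotv v v *: u - dotv u v *: v in
  dotv w w = dotv v v * (dotv u u * dotv v v - dotv u v ^+ 2).
Proof.
move=> w.
have dotvBl a b c : dotv (a - b) c = dotv a c - dotv b c :> R.
  by rewrite /dotv -sumrB; apply: eq_bigr => i _; rewrite !mxE mulrBl.
rewrite /w dotvBl ![dotv _ (_ - _)]dotvC !dotvBl !dotvZl.
rewrite ![dotv _ (_ *: _)]dotvC !dotvZl [dotv v u]dotvC.
ring.
Qed.

Lemma dotv_CS u v : v != 0 -> dotv u v ^+ 2 <= dotv u u * dotv v v.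
Proof.
move=> v0; have := dotv_ge0 (dotv v v *: u - dotv u v *: v).
rewrite dotv_rejection pmulr_rge0 ?subr_ge0 //.
by rewrite lt_def dotv_eq0 v0 dotv_ge0.
Qed.

Lemma dotv_CS_eq u v : v != 0 ->
  dotv u v ^+ 2 = dotv u u * dotv v v -> u \in <[v]>%VS.
Proof.
move=> v0 e; have := dotv_rejection u v => /=.
rewrite e subrr mulr0 => /eqP; rewrite dotv_eq0 subr_eq0 => /eqP h.
apply/vlineP; exists ((dotv v v)^-1 * dotv u v).
by rewrite -scalerA -h scalerA mulVf ?scale1r // dotv_eq0.
Qed.

Lemma cos_angle_sqr u v : u != 0 -> v != 0 ->
  dotv u v ^+ 2 = cos (angle u v) ^+ 2 * (dotv u u * dotv v v).
Proof.
move=> u0 v0.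
have p (w : 'rV[R]_n) : w != 0 -> 0 < dotv w w.
  by move=> w0; rewrite lt_def dotv_eq0 w0 dotv_ge0.
have enormE (w : 'rV[R]_n) : enorm w ^+ 2 = dotv w w.
  by rewrite sqr_sqrtr // dotv_ge0.
have ep : 0 < enorm u * enorm v by rewrite mulr_gt0 // sqrtr_gt0 p.
have q0 : 0 <= `|dotv u v| / (enorm u * enorm v).
  by rewrite divr_ge0 // ltW.
have q1 : `|dotv u v| / (enorm u * enorm v) <= 1.
  rewrite ler_pdivrMr // mul1r -(@ler_pXn2r _ 2) ?nnegrE ?normr_ge0 //; last exact: ltW.
  by rewrite real_normK ?num_real // exprMn !enormE dotv_CS.
rewrite /angle acosK; last by rewrite in_itv /= q1 andbT (le_trans _ q0) // lerN10.
rewrite expr_div_n real_normK ?num_real // exprMn !enormE.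
by rewrite divfK // mulf_neq0 // dotv_eq0.
Qed.

End CauchySchwarz.

(** * Lines and sets with few distances *)

Section Lines.
Variables (R : realType) (n : nat).
Implicit Types U V : Gr R 1 n.

Lemma vpick_line_neq0 U : vpick (val U) != 0.
Proof.
case: U => U /= /eqP dU; rewrite vpick0; apply/eqP => U0.
by move: dU; rewrite U0 dimv0.
Qed.

Lemma line_vlineE U : val U = <[vpick (val U)]>%VS.
Proof.
apply/eqP; rewrite eq_sym eqEdim -memvE memv_pick dim_vline vpick_line_neq0.
by rewrite (eqP (valP U)).
Qed.

Lemma cos_line_angle_neq1 U V : U != V -> cos (line_angle U V) ^+ 2 != 1.
Proof.
apply: contra_neq => c1.
have := cos_angle_sqr (vpick_line_neq0 U) (vpick_line_neq0 V).
rewrite -/(line_angle U V) c1 mul1r => /(dotv_CS_eq (vpick_line_neq0 V)).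
rewrite -line_vlineE => uV; apply/val_inj/eqP.
by rewrite eqEdim (eqP (valP U)) (eqP (valP V)) leqnn andbT line_vlineE -memvE.
Qed.

End Lines.

(** [g] recovers the squared cosine of the angle from the distance, so that the
    condition on [delta] becomes one on inner products and both distances are
    treated alike.  The forms dual to the lines of [S] have degree twice the
    number of distances, which is at most [2 * s]; the binomial coefficient is
    monotone in that degree. *)
Lemma card_le_of_cos_sqr (R : realType) (n : nat)
    (delta : Gr R 1 n -> Gr R 1 n -> R) (g : R -> R) (s : nat)
    (S : {fset (Gr R 1 n)}) :
  (0 < n)%N ->
  (forall U V, cos (line_angle U V) ^+ 2 = g (delta U V)) ->
  s_distance_set delta s S ->
  (#|` S| <= 'C(n + 2 * s - 1, n - 1))%N.
Proof.
case: n delta S => // m delta S _ gE sS.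
pose D := distances delta S; pose w (U : Gr R 1 m.+1) := vpick (val U).
pose factor U d x := dotv (w U) x * dotv (w U) x
  + - (g d * dotv (w U) (w U)) * dotv x x.
pose F U x := \prod_(d <- D) factor U d x.
have Fform U : is_form (size D * 2) (F U).
  apply: is_form_prod => d; apply: is_formD.
    by apply: (@is_formM _ _ 1 1); apply: is_form_dotv.
  by apply: is_formZ; apply: is_form_dotvv.
have F0 U V : U \in S -> V \in S -> (F U (w V) == 0) = (U != V).
  move=> US VS; rewrite prodf_seq_eq0; apply/hasP/idP => [[d dD]|UV].
    apply: contraTneq => <-.
    (* At [w U] the factor of [d] is [|w U|^4 (1 - g d)], and [g d = 1] would
       make two distinct lines of [S] coincide. *)
    have [U' [V' [_ _ UV' ->]]] := (distancesP _ _ _).1 dD.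
    have -> : factor U (delta U' V') (w U)
        = dotv (w U) (w U) ^+ 2 * (1 - g (delta U' V')) by rewrite /factor; ring.
    rewrite mulf_neq0 ?expf_neq0 ?dotv_eq0 ?vpick_line_neq0 //.
    by rewrite subr_eq0 eq_sym -gE cos_line_angle_neq1.
  (* The factor of the distance between [U] and [V] vanishes at [w V]. *)
  exists (delta U V); first by apply/distancesP; exists U, V.
  rewrite /= /factor -expr2 -gE cos_angle_sqr ?vpick_line_neq0 //.
  by apply/eqP; ring.
pose U (i : 'I_#|` S|) := tnth (in_tuple (enum_fset S)) i.
have US i : U i \in S by apply: mem_tnth.
have Uinj : injective U by apply/tuple_uniqP; apply: fset_uniq.
have := @card_le_of_dual_forms _ _ _ _ (F \o U) (w \o U)
  (fun i => Fform (U i)).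
move=> /(_ _)/leq_trans; apply => [i j|] /=.
  by rewrite F0 // (inj_eq Uinj).
have -> : (m.+1 + 2 * s - 1 = m + s * 2)%N by lia.
have -> : (m.+1 - 1 = m)%N by lia.
rewrite -[X in (X <= _)%N]bin_sub ?leq_addr // addKn addnC.
by apply: leq_bin2l; rewrite leq_add2l leq_mul2r.
Qed.

(** The empty set realizes the cardinality 0, so the set of cardinalities is
    nonempty and bounded, and has a maximum. *)
Lemma is_max_s_distance_exists (R : realType) (T : choiceType)
    (delta : T -> T -> R) (s B : nat) :
  (forall S : {fset T}, s_distance_set delta s S -> (#|` S| <= B)%N) ->
  exists N, is_max_s_distance delta s N /\ (N <= B)%N.
Proof.
move=> SB.
pose P k := `[< exists S : {fset T}, s_distance_set delta s S /\ #|` S| = k >].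
have P0 : exists k, P k.
  exists 0%N; apply/asboolP; exists fset0; split; last exact: cardfs0.
  rewrite /s_distance_set (_ : distances _ _ = fset0) ?cardfs0 //.
  by apply/fsetP => d; rewrite inE; apply/negP => /distancesP[U [V []]]; rewrite inE.
have PB k : P k -> (k <= B)%N by move/asboolP => [S [/SB h <-]].
case: (ex_maxnP P0 PB) => N PN Nmax; exists N; split; last exact: PB.
split; first exact/asboolP.
by move=> S sS; apply: Nmax; apply/asboolP; exists S.
Qed.

Theorem proposition4p6 (R : realType) (n s : nat) (hn : (0 < n)%N)
    (hs : (0 < s)%N) (delta : Gr R 1 n -> Gr R 1 n -> R)
    (hdelta : delta = @d_C R n \/ delta = @d_FS R n) :
  exists N : nat, is_max_s_distance delta s N /\
    (N <= 'C(n + 2 * s - 1, n - 1) + 'C(n + 2 * s - 2, n - 1))%N.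
Proof.
have [g gE] : exists g : R -> R,
    forall U V, cos (line_angle U V) ^+ 2 = g (delta U V).
  case: hdelta => ->.
    by exists (fun d => 1 - d ^+ 2) => U V; rewrite /d_C -cos2sin2.
  by exists (fun d => cos d ^+ 2).
have [N [Nmax NB]] : exists N, is_max_s_distance delta s N /\
    (N <= 'C(n + 2 * s - 1, n - 1))%N.
  by apply: is_max_s_distance_exists => S; apply: card_le_of_cos_sqr hn gE.
by exists N; split; last exact: leq_trans NB (leq_addr _ _).
Qed.
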